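(* For every $n,e\in\mathbb N$, consider the following code for single-bit messages on two shares $A,B$ of $n$ qubits each: $\mathrm{Enc}(0)=|\Phi\rangle\langle\Phi|^{\otimes n}_{AB}$ ($n$ EPR pairs), and $\mathrm{Enc}(1)$ is obtained by sampling $(a,b)\in\mathbb F_2^n\times\mathbb F_2^n$ uniformly conditioned on $(a,b)\neq(0^n,0^n)$ and outputting $(X^a\otimes Z^b)|\Phi\rangle^{\otimes n}$ (with $X^a$ on $A$ and $Z^b$ on $B$). $\mathrm{Dec}$ measures each of the $n$ pairs in the Bell basis, obtaining $a',b'\in\{0,1\}^n$, and outputs $0$ iff $a'=b'=0^n$, else $1$. This code is perfectly correct and is non-malleable against $\mathsf{LOCC}^2_e$ with error $2^{1+e-n}$.
   Context: For $a\in\mathbb F_2^n$, $X^a=\bigotimes_iX^{a_i}$ and $Z^a=\bigotimes_iZ^{a_i}$ are $n$-qubit Pauli operators. $\mathsf{LOCC}^2_e$ is the set of bipartite channels implementable by two parties holding the two shares using local quantum operations and unbounded classical communication, assisted by a pre-shared entangled state of at most $e$ qubits (Schmidt number at most $2^e$). A code for classical messages with quantum codewords is non-malleable against a class $\mathcal F$ of channels with error $\varepsilon$ if for every $\Lambda\in\mathcal F$ there are $p_\Lambda\in[0,1]$ and a distribution $D_\Lambda$ on messages, independent of the message, such that for every message $m$ the output distribution of $\mathrm{Dec}\circ\Lambda\circ\mathrm{Enc}(m)$ is within statistical distance $\varepsilon$ of $p_\Lambda\cdot m+(1-p_\Lambda)\cdot D_\Lambda$. *)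

(* Defs.v *)
From mathcomp Require Import all_boot all_algebra.
From mathcomp Require Export mxtens complex.
From mathcomp Require Export reals.

Set Implicit Arguments.
Unset Strict Implicit.
Unset Printing Implicit Defensive.

Import GRing.Theory Num.Theory.
Local Open Scope ring_scope.

Section Quantum.
Variable C : numClosedFieldType.

Definition adj m n (A : 'M[C]_(m, n)) : 'M[C]_(n, m) := (map_mx Num.conj A)^T.

Definition psd d (A : 'M[C]_d) : Prop :=
  A = adj A /\ forall v : 'cV[C]_d, 0 <= (adj v *m A *m v) 0 0.

Definition density d (rho : 'M[C]_d) : Prop := psd rho /\ \tr rho = 1.

Definition kraus_apply m n (Ks : seq 'M[C]_(n, m)) (rho : 'M[C]_m) : 'M[C]_n :=
  \sum_(K <- Ks) K *m rho *m adj K.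

(* LOCC protocols (finitely many, but unboundedly many, rounds), given by the
   Kraus operators of all their leaves.  A bipartite system is A (x) B, encoded
   as 'I_(dA * dB) via the Kronecker product.  In each round one party applies
   a local quantum instrument (fine-grained: one Kraus operator per outcome,
   sum K^* K = 1, with arbitrary output dimension), announces the outcome j,
   and the protocol continues with an LOCC protocol (F j) chosen as a function
   of j. *)
Inductive loccK : forall dA dB dA' dB' : nat,
    seq 'M[C]_(dA' * dB', dA * dB) -> Prop :=
| loccK_done dA dB : @loccK dA dB dA dB [:: 1%:M]
| loccK_A dA dB dM dA' dB' (k : nat) (K : 'I_k -> 'M[C]_(dM, dA))
    (F : 'I_k -> seq 'M[C]_(dA' * dB', dM * dB)) :
    \sum_(j < k) adj (K j) *m K j = 1%:M ->
    (forall j, @loccK dM dB dA' dB' (F j)) ->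
    @loccK dA dB dA' dB'
      (flatten [seq [seq L *m (K j *t (1%:M : 'M[C]_dB)) | L <- F j]
               | j <- enum 'I_k])
| loccK_B dA dB dM dA' dB' (k : nat) (K : 'I_k -> 'M[C]_(dM, dB))
    (F : 'I_k -> seq 'M[C]_(dA' * dB', dA * dM)) :
    \sum_(j < k) adj (K j) *m K j = 1%:M ->
    (forall j, @loccK dA dM dA' dB' (F j)) ->
    @loccK dA dB dA' dB'
      (flatten [seq [seq L *m ((1%:M : 'M[C]_dA) *t K j) | L <- F j]
               | j <- enum 'I_k]).

Definition is_LOCC dA dB dA' dB'
    (Lam : 'M[C]_(dA * dB) -> 'M[C]_(dA' * dB')) : Prop :=
  exists Ls, @loccK dA dB dA' dB' Ls /\ forall rho, Lam rho = kraus_apply Ls rho.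

Definition ket d (i : 'I_d) : 'cV[C]_d := delta_mx i 0.

Definition schmidt_rank_le dA dB (s : nat) (v : 'cV[C]_(dA * dB)) : Prop :=
  exists (x : 'I_s -> 'cV[C]_dA) (y : 'I_s -> 'cV[C]_dB),
    v = \sum_(k < s) (x k *t y k).

(* bipartite (mixed) state of Schmidt number at most s: a mixture of
   (unnormalized) pure states each of Schmidt rank at most s *)
Definition schmidt_number_le dA dB (s : nat) (psi : 'M[C]_(dA * dB)) : Prop :=
  exists (k : nat) (v : 'I_k -> 'cV[C]_(dA * dB)),
    (forall j, schmidt_rank_le s (v j)) /\
    psi = \sum_(j < k) v j *m adj (v j).

Definition regroup dA dB dEA dEB :
    'M[C]_((dA * dEA) * (dB * dEB), (dA * dB) * (dEA * dEB)) :=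
  \sum_(a < dA) \sum_(b < dB) \sum_(ea < dEA) \sum_(eb < dEB)
    (((ket a *t ket ea) *t (ket b *t ket eb))
       *m adj ((ket a *t ket b) *t (ket ea *t ket eb))).

Definition LOCC2e (e : nat) dA dB (Lam : 'M[C]_(dA * dB) -> 'M[C]_(dA * dB))
  : Prop :=
  exists (dEA dEB : nat) (psi : 'M[C]_(dEA * dEB))
         (Gam : 'M[C]_((dA * dEA) * (dB * dEB)) -> 'M[C]_(dA * dB)),
    density psi /\ schmidt_number_le (2 ^ e) psi /\
    is_LOCC Gam /\
    forall rho, Lam rho =
      Gam (regroup dA dB dEA dEB *m (rho *t psi) *m adj (regroup dA dB dEA dEB)).

Definition stat_dist (M : finType) (P Q : M -> C) : C :=
  2^-1 * \sum_(m : M) `|P m - Q m|.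

Definition is_distr (M : finType) (D : M -> C) : Prop :=
  (forall m, 0 <= D m) /\ \sum_(m : M) D m = 1.

Definition point_distr (M : finType) (m : M) : M -> C :=
  fun m' => (m' == m)%:R.

Definition perfectly_correct (M : finType) d (Enc : M -> 'M[C]_d)
    (Dec : 'M[C]_d -> M -> C) : Prop :=
  forall m, Dec (Enc m) = point_distr m.

Definition non_malleable (M : finType) d (Enc : M -> 'M[C]_d)
    (Dec : 'M[C]_d -> M -> C) (F : ('M[C]_d -> 'M[C]_d) -> Prop) (eps : C)
  : Prop :=
  forall Lam, F Lam ->
    exists (p : C) (D : M -> C),
      0 <= p <= 1 /\ is_distr D /\
      forall m : M,
        stat_dist (Dec (Lam (Enc m)))
                  (fun m' => p * point_distr m m' + (1 - p) * D m') <= eps.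

(* bit k of the binary expansion of i : 'I_(2^n); qubit k <-> bit k *)
Definition bits n (i : 'I_(2 ^ n)) : {ffun 'I_n -> bool} :=
  [ffun k : 'I_n => odd (i %/ 2 ^ k)].

(* X^a = tensor_k X^{a_k} : |x> |-> |x xor a> *)
Definition Xop n (a : {ffun 'I_n -> bool}) : 'M[C]_(2 ^ n) :=
  \matrix_(i, j) (bits i == [ffun k => addb (bits j k) (a k)])%:R.

(* Z^b = tensor_k Z^{b_k} : |x> |-> (-1)^{b.x} |x> *)
Definition Zop n (b : {ffun 'I_n -> bool}) : 'M[C]_(2 ^ n) :=
  \matrix_(i, j) ((i == j)%:R * (-1) ^+ (\sum_(k < n) (b k && bits i k))).

(* 2^{n/2} |Phi>^{(x) n} = sum_x |x>_A |x>_B *)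
Definition epr_un n : 'cV[C]_(2 ^ n * 2 ^ n) :=
  \sum_(x < 2 ^ n) (ket x *t ket x).

Definition bell_state n (a b : {ffun 'I_n -> bool}) : 'M[C]_(2 ^ n * 2 ^ n) :=
  let u := (Xop a *t Zop b) *m epr_un n in ((2 ^ n)%:R)^-1 *: (u *m adj u).

Definition zero_bits n : {ffun 'I_n -> bool} := [ffun => false].

Definition Enc n (m : bool) : 'M[C]_(2 ^ n * 2 ^ n) :=
  if m then
    (((2 ^ n * 2 ^ n)%N - 1)%:R)^-1 *:
      \sum_(ab : {ffun 'I_n -> bool} * {ffun 'I_n -> bool}
            | ab != (zero_bits n, zero_bits n)) bell_state ab.1 ab.2
  else bell_state (zero_bits n) (zero_bits n).

Definition Dec n (sigma : 'M[C]_(2 ^ n * 2 ^ n)) : bool -> C :=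
  fun m => \sum_(ab : {ffun 'I_n -> bool} * {ffun 'I_n -> bool}
                 | (ab != (zero_bits n, zero_bits n)) == m)
             \tr (bell_state ab.1 ab.2 *m sigma).

End Quantum.

(* Main.v *)
(* The decoder projects on the EPR state Phi (local dimension N = 2^n), and
   Enc(1) is proportional to I - Phi.  A pure state of Schmidt rank s is an
   N x N matrix M of rank s, with overlap |tr M|^2 / N <= (s / N) |M|_F^2 with
   Phi, by Cauchy-Schwarz.  An LOCC channel assisted by e ebits maps each product
   basis state to a state of Schmidt number at most 2^e, so it sends the maximally
   mixed state to one of fidelity at most 2^(e-n) with Phi.  That state is
   Enc(1) up to weight 1/N^2 on Phi, hence a tampered Enc(1) decodes to 0 with
   probability q <= 2^(1+e-n).  Take p to be the probability that a tampered
   Enc(0) decodes to 0, and D the point mass at 1: the error is then 0 on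
   message 0 and q on message 1. *)
Require Import Defs.
From mathcomp Require Import all_boot all_order all_algebra.
From mathcomp Require Import mxtens complex reals zify.
Import Order.TTheory GRing.Theory Num.Theory.
Local Open Scope ring_scope.

Set Implicit Arguments.
Unset Strict Implicit.
Unset Printing Implicit Defensive.

(** * Index arithmetic of Kronecker products *)

Lemma big_mxtens (V : nmodType) m n (F : 'I_(m * n) -> V) :
  \sum_(k < m * n) F k = \sum_(i < m) \sum_(j < n) F (mxtens_index (i, j)).
Proof.
rewrite pair_big (reindex (@mxtens_index m n)) /=; last first.
  by exists (@mxtens_unindex m n) => k _; rewrite ?mxtens_indexK ?mxtens_unindexK.
by apply: eq_bigr => -[].
Qed.

Lemma mxtens_index_eq m n (i k : 'I_m) (j l : 'I_n) :
  (mxtens_index (i, j) == mxtens_index (k, l)) = (i == k) && (j == l).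
Proof. by rewrite (can_eq (@mxtens_indexK m n)) xpair_eqE. Qed.

(** * Adjoints, traces and a Cauchy-Schwarz bound by rank *)

Section Adjoint.
Variable C : numClosedFieldType.

Lemma adjE m n (A : 'M[C]_(m, n)) i j : adj A i j = (A j i)^*.
Proof. by rewrite !mxE. Qed.

Lemma adjK m n : cancel (@adj C m n) (@adj C n m).
Proof. by move=> A; apply/matrixP => i j; rewrite !adjE conjCK. Qed.

Lemma adj_mul m n p (A : 'M[C]_(m, n)) (B : 'M_(n, p)) :
  adj (A *m B) = adj B *m adj A.
Proof. by rewrite /adj map_mxM trmx_mul. Qed.

Lemma adj_tens m n p q (A : 'M[C]_(m, n)) (B : 'M[C]_(p, q)) :
  adj (A *t B) = adj A *t adj B.
Proof. by rewrite /adj map_mxT trmx_tens. Qed.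

Lemma adj1 n : adj (1%:M : 'M[C]_n) = 1%:M.
Proof. by rewrite /adj map_mx1 trmx1. Qed.

Lemma adj_delta m n i j : adj (delta_mx i j : 'M[C]_(m, n)) = delta_mx j i.
Proof. by rewrite /adj map_delta_mx trmx_delta. Qed.

Lemma adj_sum m n I (r : seq I) (F : I -> 'M[C]_(m, n)) :
  adj (\sum_(i <- r) F i) = \sum_(i <- r) adj (F i).
Proof. by rewrite /adj !raddf_sum. Qed.

Lemma adjB m n (A B : 'M[C]_(m, n)) : adj (A - B) = adj A - adj B.
Proof. by rewrite /adj !raddfB. Qed.

Lemma adjZ m n c (A : 'M[C]_(m, n)) : adj (c *: A) = c^* *: adj A.
Proof. by rewrite /adj map_mxZ linearZ. Qed.

Lemma trace_adj n (A : 'M[C]_n) : \tr (adj A) = (\tr A)^*.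
Proof. by rewrite /adj mxtrace_tr /mxtrace rmorph_sum; apply: eq_bigr => i _; rewrite mxE. Qed.

Lemma trace_adj_mul m n (A B : 'M[C]_(m, n)) : \tr (A *m adj B) = \sum_i \sum_j A i j * (B i j)^*.
Proof. by apply: eq_bigr => i _; rewrite mxE; apply: eq_bigr => j _; rewrite adjE. Qed.

Lemma trace_adj_ge0 m n (A : 'M[C]_(m, n)) : 0 <= \tr (A *m adj A).
Proof.
rewrite trace_adj_mul; apply: sumr_ge0 => i _; apply: sumr_ge0 => j _.
exact: mul_conjC_ge0.
Qed.

(* Expand |r A - <A, B> B|^2 >= 0. *)
Lemma trace_isometry_le r n (A B : 'M[C]_(r, n)) : B *m adj B = 1%:M ->
  `|\tr (A *m adj B)| ^+ 2 <= r%:R * \tr (A *m adj A).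
Proof.
case: r A B => [|r] A B hB.
  by rewrite /mxtrace !big_ord0 normr0 expr0n mul0r.
set t := \tr (A *m adj B); set a := \tr (A *m adj A).
have := trace_adj_ge0 (r.+1%:R *: A - t *: B).
rewrite adjB !adjZ mulmxBl !mulmxBr -!scalemxAl -!scalemxAr hB !linearB /= !linearZ /=.
have -> : \tr (B *m adj A) = t^* by rewrite -trace_adj adj_mul adjK.
rewrite -/t -/a mxtrace1 conjC_nat normCK.
set R := r.+1%:R.
have -> : R * (R * a) - R * (t^* * t) - (t * (R * t^*) - t * (t^* * R)) = R * (R * a - t * t^*).
  by rewrite mulrBr [t * (R * _)]mulrCA mulrA [t * (t^* * _)]mulrA [t * t^* * R]mulrC
    subrr subr0 [t^* * t]mulrC mulrA.
by rewrite pmulr_rge0 ?subr_ge0 // ltr0Sn.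
Qed.

(** Gram-Schmidt on a row basis gives [M = Y *m U], where [U] has [\rank M] orthonormal rows. Up to
    conjugation [\tr M] is the inner product of [adj Y] with [U], and [Y] has the Frobenius norm of
    [M], so [trace_isometry_le] applies. *)
Lemma trace_rank_le N s (M : 'M[C]_N) : (\rank M <= s)%N ->
  `|\tr M| ^+ 2 <= s%:R * \tr (M *m adj M).
Proof.
move=> hs; apply: (@le_trans _ _ ((\rank M)%:R * \tr (M *m adj M))); last first.
  by rewrite ler_wpM2r ?trace_adj_ge0 // ler_nat.
set U := schmidt (row_base M).
have hU : U *m adj U = 1%:M.
  have := schmidt_unitarymx (row_base M) (rank_leq_col M).
  by move/unitarymxP; rewrite /adj -map_trmx.
have /submxP [Y hY] : (M <= U)%MS.
  by apply: submx_trans (schmidt_sub _); rewrite eq_row_base.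
have := trace_isometry_le (adj Y) hU.
rewrite -adj_mul trace_adj mxtrace_mulC -hY norm_conjC adjK.
suff -> : \tr (M *m adj M) = \tr (adj Y *m Y) by [].
transitivity (\tr ((Y *m U) *m adj (Y *m U))).
  by rewrite -hY.
by rewrite adj_mul mulmxA -[_ *m adj U]mulmxA hU mulmx1 [RHS]mxtrace_mulC.
Qed.

End Adjoint.

(** * Bipartite vectors as matrices; Schmidt rank and Schmidt number *)

Section Bipartite.
Variable C : numClosedFieldType.

(** The amplitude matrix of a bipartite vector. It turns Schmidt rank into matrix rank, the norm
    into the Frobenius norm, and the overlap with the EPR vector into the trace. *)
Definition unvec m n (u : 'cV[C]_(m * n)) : 'M[C]_(m, n) :=
  \matrix_(i, j) u (mxtens_index (i, j)) 0.

Lemma tens_colE m n (x : 'cV[C]_m) (y : 'cV[C]_n) i j l :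
  (x *t y) (mxtens_index (i, j)) l = x i 0 * y j 0.
Proof. by rewrite mxE mxtens_indexK !ord1. Qed.

Lemma unvec_tens m n (x : 'cV[C]_m) (y : 'cV[C]_n) : unvec (x *t y) = x *m y^T.
Proof.
by apply/matrixP => i j; rewrite mxE tens_colE mxE big_ord1 mxE.
Qed.

Lemma unvec_sum m n I (r : seq I) (F : I -> 'cV[C]_(m * n)) :
  unvec (\sum_(i <- r) F i) = \sum_(i <- r) unvec (F i).
Proof.
apply/matrixP => i j; rewrite mxE !summxE; apply: eq_bigr => k _.
by rewrite mxE.
Qed.

Lemma unvec_norm m n (u : 'cV[C]_(m * n)) :
  \tr (u *m adj u) = \tr (unvec u *m adj (unvec u)).
Proof.
rewrite !trace_adj_mul big_mxtens; apply: eq_bigr => i _; apply: eq_bigr => j _.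
by rewrite big_ord1 !mxE.
Qed.

Lemma ket_tens m n (i : 'I_m) (j : 'I_n) :
  ket C i *t ket C j = ket C (mxtens_index (i, j)).
Proof.
apply/matrixP => k l; case: (mxtens_indexP k) => k1 k2.
rewrite tens_colE !mxE mxtens_index_eq !ord1 !eqxx !andbT.
by rewrite -natrM mulnb.
Qed.

(** A sum of [s] outer products is a single matrix product with inner dimension [s]. *)
Lemma schmidt_rank_le_rank m n s (u : 'cV[C]_(m * n)) :
  schmidt_rank_le s u -> (\rank (unvec u) <= s)%N.
Proof.
case=> x [y ->]; rewrite unvec_sum.
have -> : \sum_(k < s) unvec (x k *t y k) =
    (\matrix_(i < m, k < s) x k i 0) *m (\matrix_(k < s, j < n) y k j 0).
  apply/matrixP => i j; rewrite summxE !mxE; apply: eq_bigr => k _.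
  by rewrite unvec_tens !mxE big_ord1 !mxE.
exact: leq_trans (mxrankM_maxr _ _) (rank_leq_row _).
Qed.

(** Expand [u] along the standard basis of the first factor; the partners are the rows of its
    amplitude matrix. *)
Lemma schmidt_rank_le_full m n (u : 'cV[C]_(m * n)) : schmidt_rank_le m u.
Proof.
exists (fun i => ket C i), (fun i => \col_j u (mxtens_index (i, j)) 0).
apply/matrixP => k l; case: (mxtens_indexP k) => k1 k2.
rewrite summxE (bigD1 k1) //= big1 => [|i ne].
  by rewrite tens_colE !mxE !eqxx mul1r addr0 !ord1.
by rewrite tens_colE !mxE eq_sym (negPf ne) mul0r.
Qed.

Lemma schmidt_rank_le_tensmx dA dB dA' dB' s (A : 'M[C]_(dA', dA)) (B : 'M[C]_(dB', dB)) u :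
  schmidt_rank_le s u -> schmidt_rank_le s ((A *t B) *m u).
Proof.
case=> x [y ->]; exists (fun k => A *m x k), (fun k => B *m y k).
by rewrite mulmx_sumr; apply: eq_bigr => k _; rewrite (tensmx_mul A B (x k) (y k)).
Qed.

Lemma schmidt_number_le0 dA dB s : schmidt_number_le s (0 : 'M[C]_(dA * dB)).
Proof. by exists 0, (fun=> 0); split => [[]//|]; rewrite big_ord0. Qed.

Lemma schmidt_number_leD dA dB s (rho sigma : 'M[C]_(dA * dB)) :
  schmidt_number_le s rho -> schmidt_number_le s sigma ->
  schmidt_number_le s (rho + sigma).
Proof.
move=> [k [v [hv ->]]] [l [w [hw ->]]].
exists (k + l)%N, (fun i => match split i with inl j => v j | inr j => w j end).
split=> [i|]; first by case: splitP.
rewrite big_split_ord /=; congr (_ + _); apply: eq_bigr => i _.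
  by rewrite (unsplitK (inl i)).
by rewrite (unsplitK (inr i)).
Qed.

Lemma schmidt_number_le_sum dA dB s (I : eqType) (r : seq I) (F : I -> 'M[C]_(dA * dB)) :
  (forall i, i \in r -> schmidt_number_le s (F i)) ->
  schmidt_number_le s (\sum_(i <- r) F i).
Proof.
move=> h; rewrite big_seq.
by elim/big_rec: _ => [|i x hi]; [exact: schmidt_number_le0 | exact/schmidt_number_leD/h].
Qed.

(** Retains just the positivity of [rho], as a sum of terms [v *m adj v], together with the trivial
    rank bound. *)
Lemma schmidt_number_le_full dA dB s (rho : 'M[C]_(dA * dB)) :
  schmidt_number_le s rho -> schmidt_number_le dA rho.
Proof. by case=> k [v [_ ->]]; exists k, v; split=> // j; apply: schmidt_rank_le_full. Qed.

Lemma schmidt_number_le_tensmx dA dB dA' dB' s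
    (A : 'M[C]_(dA', dA)) (B : 'M[C]_(dB', dB)) rho :
  schmidt_number_le s rho ->
  schmidt_number_le s ((A *t B) *m rho *m adj (A *t B)).
Proof.
case=> k [v [hv ->]]; exists k, (fun j => (A *t B) *m v j); split.
  by move=> j; apply: schmidt_rank_le_tensmx.
rewrite mulmx_sumr mulmx_suml; apply: eq_bigr => j _.
by rewrite adj_mul !mulmxA.
Qed.

Lemma schmidt_number_le_kraus dA dB dA' dB' s (Ls : seq 'M[C]_(dA' * dB', dA * dB)) rho :
  (forall L, L \in Ls -> exists A B, L = A *t B) ->
  schmidt_number_le s rho -> schmidt_number_le s (kraus_apply Ls rho).
Proof.
move=> hL hrho; apply: schmidt_number_le_sum => L /hL [A [B ->]].
exact: schmidt_number_le_tensmx.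
Qed.

(** * Kraus operators of LOCC protocols *)

Lemma tens11 m n : (1%:M : 'M[C]_m) *t (1%:M : 'M[C]_n) = 1%:M.
Proof.
apply/matrixP => i j; case: (mxtens_indexP i) => i1 i2; case: (mxtens_indexP j) => j1 j2.
by rewrite tensmxE !mxE mxtens_index_eq -natrM mulnb.
Qed.

(** Each round multiplies one local factor and leaves the other alone, so LOCC operations are
    separable. This is what keeps a protocol from raising the Schmidt number. *)
Lemma loccK_product dA dB dA' dB' (Ls : seq 'M[C]_(dA' * dB', dA * dB)) :
  loccK Ls -> forall L, L \in Ls -> exists A B, L = A *t B.
Proof.
elim=> {dA dB dA' dB' Ls} [dA dB|dA dB dM dA' dB' k K F _ _ IH|dA dB dM dA' dB' k K F _ _ IH] L.
- by rewrite inE => /eqP->; exists 1%:M, 1%:M; rewrite tens11.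
- move=> /flatten_mapP [j _ /mapP [L' /IH [A [B ->]] ->]].
  by exists (A *m K j), B; rewrite tensmx_mul mulmx1.
- move=> /flatten_mapP [j _ /mapP [L' /IH [A [B ->]] ->]].
  by exists A, (B *m K j); rewrite tensmx_mul mulmx1.
Qed.

Lemma tensmx_suml m n p q I (r : seq I) (F : I -> 'M[C]_(m, n)) (B : 'M[C]_(p, q)) :
  (\sum_(i <- r) F i) *t B = \sum_(i <- r) (F i *t B).
Proof.
apply/matrixP => i j; rewrite mxE !summxE mulr_suml.
by apply: eq_bigr => k _; rewrite mxE.
Qed.

Lemma tensmx_sumr m n p q I (r : seq I) (A : 'M[C]_(m, n)) (F : I -> 'M[C]_(p, q)) :
  A *t (\sum_(i <- r) F i) = \sum_(i <- r) (A *t F i).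
Proof.
apply/matrixP => i j; rewrite mxE !summxE mulr_sumr.
by apply: eq_bigr => k _; rewrite mxE.
Qed.

(** The leaves below outcome [j] sum to the identity, which sits between [adj (K j)] and [K j] and
    disappears. *)
Lemma kraus_comp m n p k (K : 'I_k -> 'M[C]_(n, m)) (F : 'I_k -> seq 'M[C]_(p, n)) :
  \sum_(j < k) adj (K j) *m K j = 1%:M ->
  (forall j, \sum_(L <- F j) adj L *m L = 1%:M) ->
  \sum_(L <- flatten [seq [seq L *m K j | L <- F j] | j <- enum 'I_k])
     adj L *m L = 1%:M.
Proof.
move=> hK hF; rewrite big_flatten big_map big_enum -[RHS]hK /=.
apply: eq_bigr => j _; rewrite big_map.
rewrite -[X in _ *m X](mul1mx (K j)) -(hF j) mulmx_suml mulmx_sumr.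
by apply: eq_bigr => L _; rewrite adj_mul !mulmxA.
Qed.

Lemma loccK_complete dA dB dA' dB' (Ls : seq 'M[C]_(dA' * dB', dA * dB)) :
  loccK Ls -> \sum_(L <- Ls) adj L *m L = 1%:M.
Proof.
elim=> {dA dB dA' dB' Ls} [dA dB|dA dB dM dA' dB' k K F hK _ IH|dA dB dM dA' dB' k K F hK _ IH].
- by rewrite big_seq1 adj1 mulmx1.
(* A local instrument tensored with the identity of the other party is still complete. *)
- apply: kraus_comp IH; rewrite -tens11 -hK tensmx_suml; apply: eq_bigr => j _.
  by rewrite adj_tens tensmx_mul adj1 mulmx1.
- apply: kraus_comp IH; rewrite -tens11 -hK tensmx_sumr; apply: eq_bigr => j _.
  by rewrite adj_tens tensmx_mul adj1 mulmx1.
Qed.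

Lemma trace_kraus m n (Ls : seq 'M[C]_(n, m)) rho :
  \sum_(L <- Ls) adj L *m L = 1%:M -> \tr (kraus_apply Ls rho) = \tr rho.
Proof.
move=> h; rewrite -[in RHS](mul1mx rho) -h mulmx_suml !raddf_sum /=.
by apply: eq_bigr => L _; rewrite mxtrace_mulC mulmxA.
Qed.

Lemma trace_tens m n (A : 'M[C]_m) (B : 'M[C]_n) : \tr (A *t B) = \tr A * \tr B.
Proof.
rewrite /mxtrace big_mxtens mulr_suml; apply: eq_bigr => i _.
by rewrite mulr_sumr; apply: eq_bigr => j _; rewrite tensmxE.
Qed.

End Bipartite.

(** * The permutation of tensor factors that hands each party its half of the resource *)

Section Regroup.
Variable C : numClosedFieldType.
Variables dA dB dEA dEB : nat.

(** The action of [regroup] on basis indices: the two middle tensor factors are exchanged. *)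
Definition regroup_index (q : 'I_((dA * dB) * (dEA * dEB))) :
    'I_((dA * dEA) * (dB * dEB)) :=
  let: (ab, ee) := mxtens_unindex q in
  let: (a, b) := mxtens_unindex ab in
  let: (ea, eb) := mxtens_unindex ee in
  mxtens_index (mxtens_index (a, ea), mxtens_index (b, eb)).

Lemma regroup_index_inj : injective regroup_index.
Proof.
move=> p q; case: (mxtens_indexP p) => p1 p2; case: (mxtens_indexP q) => q1 q2.
case: (mxtens_indexP p1) => a b; case: (mxtens_indexP p2) => ea eb.
case: (mxtens_indexP q1) => a' b'; case: (mxtens_indexP q2) => ea' eb'.
rewrite /regroup_index !mxtens_indexK => /eqP.
by rewrite !mxtens_index_eq => /andP[/andP[/eqP-> /eqP->] /andP[/eqP-> /eqP->]].
Qed.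

Lemma regroupE : regroup C dA dB dEA dEB = \sum_q delta_mx (regroup_index q) q.
Proof.
rewrite big_mxtens big_mxtens; apply: eq_bigr => a _; apply: eq_bigr => b _.
rewrite big_mxtens; apply: eq_bigr => ea _; apply: eq_bigr => eb _.
rewrite /regroup_index !mxtens_indexK.
have -> : (ket C a *t ket C ea) *t (ket C b *t ket C eb) =
    ket C (mxtens_index (mxtens_index (a, ea), mxtens_index (b, eb))).
  by rewrite -!ket_tens.
have -> : (ket C a *t ket C b) *t (ket C ea *t ket C eb) =
    ket C (mxtens_index (mxtens_index (a, b), mxtens_index (ea, eb))).
  by rewrite -!ket_tens.
by rewrite adj_delta mul_delta_mx.
Qed.

Lemma regroup_mulE n (M : 'M[C]_(_, n)) q j :
  (regroup C dA dB dEA dEB *m M) (regroup_index q) j = M q j.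
Proof.
rewrite regroupE mulmx_suml summxE (bigD1 q) //= big1 => [|p ne].
  rewrite addr0 mxE (bigD1 q) //= big1 => [|p ne]; rewrite !mxE !eqxx ?(negPf ne) ?andbF ?mul0r //.
  by rewrite mul1r addr0.
rewrite mxE big1 // => k _; rewrite mxE (inj_eq regroup_index_inj) eq_sym.
by rewrite (negPf ne) mul0r.
Qed.

Lemma regroup_isometry :
  adj (regroup C dA dB dEA dEB) *m regroup C dA dB dEA dEB = 1%:M.
Proof.
rewrite regroupE adj_sum mx1_sum_delta mulmx_suml; apply: eq_bigr => p _.
rewrite mulmx_sumr (bigD1 p) //= adj_delta mul_delta_mx big1 ?addr0 // => q ne.
by rewrite mul_delta_mx_cond (inj_eq regroup_index_inj) eq_sym (negPf ne).
Qed.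

Lemma regroup_tens (a : 'cV[C]_dA) (b : 'cV[C]_dB) (x : 'cV[C]_dEA) (y : 'cV[C]_dEB) :
  regroup C dA dB dEA dEB *m ((a *t b) *t (x *t y)) = (a *t x) *t (b *t y).
Proof.
apply/matrixP => i l; case: (mxtens_indexP i) => i1 i2.
case: (mxtens_indexP i1) => a0 x0; case: (mxtens_indexP i2) => b0 y0.
(* Every row index lies in the image of [regroup_index], so [regroup_mulE] gives the entry. *)
have {1}-> : mxtens_index (mxtens_index (a0, x0), mxtens_index (b0, y0)) =
    regroup_index (mxtens_index (mxtens_index (a0, b0), mxtens_index (x0, y0))).
  by rewrite /regroup_index !mxtens_indexK.
rewrite (regroup_mulE ((a *t b) *t (x *t y) : 'M_(_, 1))).
by rewrite (tens_colE (a *t b) (x *t y)) (tens_colE (a *t x) (b *t y)) !tens_colE mulrACA.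
Qed.
End Regroup.

(** * Channels in the assisted class: trace, linearity, Schmidt number *)

Section AssistedLOCC.
Variable C : numClosedFieldType.

(** Across the cut between the parties, the [r] product terms of [w] and the [s] product terms of
    each component of [psi] multiply to [r * s] product terms. *)
Lemma schmidt_number_le_regroup dA dB dEA dEB r s (w : 'cV[C]_(dA * dB))
    (psi : 'M[C]_(dEA * dEB)) :
  schmidt_rank_le r w -> schmidt_number_le s psi ->
  schmidt_number_le (r * s)
    (regroup C dA dB dEA dEB *m ((w *m adj w) *t psi) *m adj (regroup C dA dB dEA dEB)).
Proof.
move=> [a [b hw]] [k [v [hv ->]]]; set W := regroup _ _ _ _ _.
exists k, (fun j => W *m (w *t v j)); split=> [j|].
  have [x [y ->]] := hv j.
  (* An index below [r * s] encodes a term of [w] and a term of [v j]. *)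
  exists (fun q => a (mxtens_unindex q).1 *t x (mxtens_unindex q).2).
  exists (fun q => b (mxtens_unindex q).1 *t y (mxtens_unindex q).2).
  rewrite hw tensmx_suml mulmx_sumr big_mxtens; apply: eq_bigr => i _.
  rewrite tensmx_sumr mulmx_sumr; apply: eq_bigr => l _.
  by rewrite mxtens_indexK regroup_tens.
rewrite tensmx_sumr mulmx_sumr mulmx_suml; apply: eq_bigr => j _.
by rewrite adj_mul (adj_tens w (v j)) -(tensmx_mul w (v j)) !mulmxA.
Qed.

Variables (e dA dB : nat) (Lam : 'M[C]_(dA * dB) -> 'M[C]_(dA * dB)).
Hypothesis hLam : LOCC2e e Lam.

Lemma LOCC2e_trace rho : \tr (Lam rho) = \tr rho.
Proof.
have [dEA [dEB [psi [Gam [[_ tpsi] [_ [[Ls [hLs hGam]] ->]]]]]]] := hLam.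
rewrite hGam trace_kraus; last exact: loccK_complete.
by rewrite mxtrace_mulC mulmxA regroup_isometry mul1mx trace_tens tpsi mulr1.
Qed.

(** [Lam] is a bare function, so additivity is read off its Kraus form. *)
Lemma LOCC2e_sum I (r : seq I) (P : pred I) (F : I -> 'M[C]_(dA * dB)) :
  Lam (\sum_(i <- r | P i) F i) = \sum_(i <- r | P i) Lam (F i).
Proof.
rewrite -[in LHS]big_filter -[RHS]big_filter; move: (filter P r) => {P}r.
have [dEA [dEB [psi [Gam [_ [_ [[Ls [_ hGam]] hL]]]]]]] := hLam.
rewrite hL hGam /kraus_apply tensmx_suml mulmx_sumr mulmx_suml.
rewrite [RHS](eq_bigr _ (fun i _ => etrans (hL _) (hGam _))) [RHS]exchange_big.
by apply: eq_bigr => L _; rewrite mulmx_sumr mulmx_suml.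
Qed.

Lemma LOCC2e_scale c rho : Lam (c *: rho) = c *: Lam rho.
Proof.
have [dEA [dEB [psi [Gam [_ [_ [[Ls [_ hGam]] hL]]]]]]] := hLam.
rewrite !hL !hGam /kraus_apply scaler_sumr; apply: eq_bigr => L _.
have -> : (c *: rho) *t psi = c *: (rho *t psi).
  by apply/matrixP => i j; rewrite !mxE mulrA.
by rewrite -!scalemxAr -!scalemxAl -scalemxAr -scalemxAl.
Qed.

(** The resource contributes the factor [2 ^ e]; the product Kraus operators contribute nothing
    more. *)
Lemma LOCC2e_schmidt r (w : 'cV[C]_(dA * dB)) :
  schmidt_rank_le r w -> schmidt_number_le (r * 2 ^ e) (Lam (w *m adj w)).
Proof.
move=> hw; have [dEA [dEB [psi [Gam [_ [hpsi [[Ls [hLs hGam]] ->]]]]]]] := hLam.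
rewrite hGam; apply: schmidt_number_le_kraus (loccK_product hLs) _.
exact: schmidt_number_le_regroup.
Qed.

End AssistedLOCC.

(** * The EPR state and the fidelity with it *)

Section Bell.
Variable C : numClosedFieldType.
Variable n : nat.
Local Notation N := (2 ^ n)%N.
Local Notation bitv := {ffun 'I_n -> bool}.
Local Notation Phi := (bell_state C (zero_bits n) (zero_bits n)).

Lemma bits_inj : injective (@bits n).
Proof.
(* The bit length [m] varies because the induction strips the lowest bit and halves both numbers. *)
suff : forall m (i j : nat), (i < 2 ^ m)%N -> (j < 2 ^ m)%N ->
    (forall k, (k < m)%N -> odd (i %/ 2 ^ k) = odd (j %/ 2 ^ k)) -> i = j.
  move=> h i j /ffunP hij; apply/val_inj/(h n _ _ (ltn_ord i) (ltn_ord j)) => k hk.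
  by have := hij (Ordinal hk); rewrite !ffunE.
elim=> [[|?] [|?] //|m IH i j hi hj hk].
rewrite -(odd_double_half i) -(odd_double_half j); have := hk 0%N; rewrite !divn1 => -> //.
congr (_ + _.*2)%N; apply: IH.
- by rewrite -divn2 ltn_divLR // mulnC -expnS.
- by rewrite -divn2 ltn_divLR // mulnC -expnS.
- by move=> k lk; rewrite -!divn2 -!divnMA -expnS hk.
Qed.

Lemma Xop0 : Xop C (zero_bits n) = 1%:M.
Proof.
apply/matrixP => i j; rewrite !mxE; congr (_ : bool)%:R.
rewrite -(inj_eq bits_inj); congr (_ == _).
by apply/ffunP => k; rewrite !ffunE addbF.
Qed.

Lemma Zop0 : Zop C (zero_bits n) = 1%:M.
Proof.
apply/matrixP => i j; rewrite !mxE big1 ?expr0 ?mulr1 // => k _.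
by rewrite ffunE.
Qed.

Lemma bell_state0 : Phi = N%:R^-1 *: (epr_un C n *m adj (epr_un C n)).
Proof. by rewrite /bell_state Xop0 Zop0 tens11 mul1mx. Qed.

Lemma epr_unE i j l : epr_un C n (mxtens_index (i, j)) l = (i == j)%:R.
Proof.
rewrite summxE (bigD1 i) //= big1 => [|x ne].
  by rewrite tens_colE !mxE !eqxx mul1r addr0 andbT eq_sym.
by rewrite tens_colE mxE eq_sym (negPf ne) mul0r.
Qed.

(** The amplitude matrix of the unnormalized EPR vector is the identity. *)
Lemma epr_overlap (u : 'cV[C]_(N * N)) :
  adj (epr_un C n) *m u = (\tr (unvec u))%:M.
Proof.
apply/matrixP => k l; rewrite !mxE !ord1 eqxx big_mxtens; apply: eq_bigr => i _.
rewrite (bigD1 i) //= big1 => [|j ne]; rewrite adjE epr_unE ?eqxx ?conjC1 ?mul1r ?addr0 ?mxE //.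
by rewrite eq_sym (negPf ne) conjC0 mul0r.
Qed.

Lemma epr_norm : adj (epr_un C n) *m epr_un C n = N%:R%:M.
Proof.
rewrite epr_overlap; congr (_%:M); rewrite -[in RHS](card_ord N) -sum1_card natr_sum.
by apply: eq_bigr => i _; rewrite mxE epr_unE eqxx.
Qed.

Lemma epr_fidelity_pure (u : 'cV[C]_(N * N)) :
  \tr (Phi *m (u *m adj u)) = N%:R^-1 * `|\tr (unvec u)| ^+ 2.
Proof.
rewrite bell_state0 -scalemxAl linearZ /=; congr (_ * _).
rewrite mulmxA -[_ *m adj _ *m u]mulmxA epr_overlap mul_mx_scalar -scalemxAl linearZ /=.
rewrite mxtrace_mulC -[adj u *m _]adjK adj_mul adjK epr_overlap.
by rewrite trace_adj mxtrace_scalar normCK.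
Qed.

(** Both bounds hold for each pure component: its fidelity is a squared trace over [N], and
    [trace_rank_le] applies to its amplitude matrix. *)
Lemma epr_fidelity_le s (sigma : 'M[C]_(N * N)) : schmidt_number_le s sigma ->
  0 <= \tr (Phi *m sigma) <= s%:R / N%:R * \tr sigma.
Proof.
case=> k [v [hv ->]]; rewrite mulmx_sumr !raddf_sum mulr_sumr /=.
apply/andP; split; [apply: sumr_ge0|apply: ler_sum] => j _; rewrite epr_fidelity_pure.
  by rewrite mulr_ge0 ?invr_ge0 ?ler0n ?exprn_ge0.
rewrite [_ / _]mulrC -mulrA ler_wpM2l ?invr_ge0 ?ler0n // unvec_norm.
exact/trace_rank_le/schmidt_rank_le_rank.
Qed.

Lemma trace_epr : \tr Phi = 1.
Proof.
rewrite bell_state0 linearZ /= mxtrace_mulC epr_norm mxtrace_scalar mulVf //.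
by rewrite pnatr_eq0 expn_eq0.
Qed.

Lemma epr_idem : Phi *m Phi = Phi.
Proof.
rewrite {1 2}bell_state0 -scalemxAl -scalemxAr mulmxA -[_ *m adj _ *m epr_un _ _]mulmxA.
rewrite epr_norm mul_mx_scalar -scalemxAl !scalerA mulVf ?mulr1 ?bell_state0 //.
by rewrite pnatr_eq0 expn_eq0.
Qed.

(** * Completeness of the Bell basis *)

Lemma XZ_eprE (a b : bitv) i j l :
  ((Xop C a *t Zop C b) *m epr_un C n) (mxtens_index (i, j)) l =
    (bits i == [ffun k => bits j k (+) a k])%:R * (-1) ^+ (\sum_(k < n) (b k && bits j k)).
Proof.
(* [Zop] is diagonal, which leaves index [j] on the second factor; the EPR vector then forces [j] on
   the first. *)
rewrite mxE big_mxtens exchange_big (bigD1 j) //= [X in _ + X]big1 ?addr0.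
  rewrite (bigD1 j) //= big1 ?addr0 => [|x ne]; rewrite epr_unE ?(negPf ne) ?mulr0 //.
  by rewrite eqxx mulr1 tensmxE !mxE eqxx mul1r.
move=> y ne; rewrite big1 // => x _; rewrite tensmxE [Zop _ _ _ _]mxE eq_sym (negPf ne).
by rewrite mul0r mulr0 mul0r.
Qed.

(** Orthogonality of characters: the sum factors over coordinates, each giving 2 where [c] and [d]
    agree and 1 - 1 = 0 where they differ. *)
Lemma sum_characters (c d : bitv) :
  \sum_(b : bitv) (-1) ^+ (\sum_(k < n) (b k && c k)) * (-1) ^+ (\sum_(k < n) (b k && d k))
    = N%:R * (c == d)%:R :> C.
Proof.
transitivity (\sum_(b : bitv) \prod_(k < n) ((-1) ^+ (b k && (c k (+) d k)) : C)).
  apply: eq_bigr => b _; rewrite !expr_sum -big_split; apply: eq_bigr => k _ /=.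
  by rewrite -signr_addb; case: (b k).
rewrite -(bigA_distr_bigA (fun (k : 'I_n) (x : bool) => (-1) ^+ (x && (c k (+) d k)))) /=.
have [->|ne] := eqVneq c d.
  rewrite mulr1 natrX -[n in RHS]card_ord -prodr_const; apply: eq_bigr => k _.
  by rewrite big_bool /= addbb.
have [k hk] : exists k, c k != d k.
  apply/existsP; rewrite -negb_forall; apply: contra ne => /forallP h.
  by apply/eqP/ffunP => k; apply/eqP/h.
rewrite (bigD1 k) //= big_bool /= addbC; move: hk; case: (c k); case: (d k) => //= _;
by rewrite expr1 expr0 addNr mul0r mulr0.
Qed.

Lemma xor_eqC (f g h : bitv) :
  (f == [ffun t => g t (+) h t]) = (h == [ffun t => g t (+) f t]).
Proof. by apply/eqP/eqP => ->; apply/ffunP => t; rewrite !ffunE addKb. Qed.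

Lemma xor_addK (f g : bitv) :
  [ffun t => g t (+) [ffun t => g t (+) f t] t] = f.
Proof. by apply/ffunP => t; rewrite !ffunE addKb. Qed.

(** Entrywise, summing over [b] forces [j = l] and cancels the normalization. A single shift [a],
    the xor of the bits of [i] and [j], then survives and forces [i = k]. *)
Lemma bell_complete : \sum_(ab : bitv * bitv) bell_state C ab.1 ab.2 = 1%:M.
Proof.
apply/matrixP => p q; case: (mxtens_indexP p) => i j; case: (mxtens_indexP q) => k l.
rewrite summxE mxE mxtens_index_eq.
transitivity (\sum_(a : bitv) (bits i == [ffun t => bits j t (+) a t])%:R *
    (bits k == [ffun t => bits l t (+) a t])%:R * (j == l)%:R : C).
  rewrite -(pair_big predT predT
    (fun a b => bell_state C a b (mxtens_index (i, j)) (mxtens_index (k, l)))) /=.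
  apply: eq_bigr => a _.
  transitivity (N%:R^-1 * ((bits i == [ffun t => bits j t (+) a t])%:R *
    (bits k == [ffun t => bits l t (+) a t])%:R * (N%:R * (bits j == bits l)%:R)) : C).
    rewrite -sum_characters !mulr_sumr; apply: eq_bigr => b _.
    rewrite /bell_state mxE; congr (_ * _).
    rewrite mxE big_ord1 adjE !XZ_eprE rmorphM rmorph_nat rmorphXn rmorphN1.
    by rewrite mulrACA.
  by rewrite (inj_eq bits_inj) mulrCA mulKf // pnatr_eq0 expn_eq0 //.
rewrite -mulr_suml (bigD1 [ffun t => bits j t (+) bits i t]) //= big1 => [|a ne]; last first.
  by rewrite xor_eqC (negPf ne) mul0r.
rewrite xor_eqC eqxx addr0 mul1r -natrM mulnb; congr (_ : bool)%:R.
have [->|] := eqVneq j l; rewrite ?andbF // !andbT.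
by rewrite xor_addK (inj_eq bits_inj) eq_sym.
Qed.

(** * Encoder and decoder in terms of [Phi]; correctness *)

Lemma bell_complete_neq0 :
  \sum_(ab : bitv * bitv | ab != (zero_bits n, zero_bits n)) bell_state C ab.1 ab.2
    = 1%:M - Phi.
Proof.
rewrite -bell_complete [in RHS](bigD1 (zero_bits n, zero_bits n)) //=.
by rewrite [in RHS]addrC addrK.
Qed.

(** By completeness, merging the nonzero Bell outcomes leaves the measurement of [Phi] against
    [1%:M - Phi]. *)
Lemma DecE (sigma : 'M[C]_(N * N)) m : Dec sigma m =
  if m then \tr sigma - \tr (Phi *m sigma) else \tr (Phi *m sigma).
Proof.
rewrite /Dec; case: m.
  under eq_bigl do rewrite eqb_id.
  by rewrite -raddf_sum -mulmx_suml bell_complete_neq0 mulmxBl mul1mx raddfB.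
by under eq_bigl do rewrite eqbF_neg negbK; rewrite big_pred1_eq.
Qed.

Lemma Enc1E : Enc C n true = ((N * N - 1)%N%:R)^-1 *: (1%:M - Phi).
Proof. by rewrite /Enc bell_complete_neq0. Qed.

Lemma Enc_correct : (0 < n)%N -> perfectly_correct (@Enc C n) (@Dec C n).
Proof.
move=> n0 m; apply/boolp.funext => m'; rewrite DecE /point_distr.
case: m; last first.
  by rewrite /Enc epr_idem trace_epr subrr; case: m'.
(* This makes the normalization [N * N - 1], the trace of [1%:M - Phi], nonzero. *)
have hN : (1 < N * N)%N by rewrite -expnD -[1%N](expn0 2) ltn_exp2l // addn_gt0 n0.
rewrite Enc1E -scalemxAr !mxtraceZ mulmxBr mulmx1 epr_idem subrr mxtrace0 mulr0 subr0.
rewrite linearB /= mxtrace1 trace_epr -(natrB _ (ltnW hN)).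
by case: m'; rewrite // mulVf // pnatr_eq0 -lt0n subn_gt0.
Qed.

(** * Fidelity of tampered codewords with [Phi] *)

Section Malleability.
Variables (e : nat) (Lam : 'M[C]_(N * N) -> 'M[C]_(N * N)).
Hypothesis hLam : LOCC2e e Lam.

(** The identity is a sum of [N * N] product basis projectors, and the image of each has fidelity at
    most [2 ^ e] over [N]. *)
Lemma LOCC2e_mixed_fidelity : \tr (Phi *m Lam 1%:M) <= (2 ^ e)%:R * N%:R.
Proof.
pose w (i j : 'I_N) : 'cV[C]_(N * N) := ket C i *t ket C j.
have {1}-> : (1%:M : 'M[C]_(N * N)) = \sum_(i < N) \sum_(j < N) w i j *m adj (w i j).
  rewrite mx1_sum_delta big_mxtens; apply: eq_bigr => i _; apply: eq_bigr => j _.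
  by rewrite /w ket_tens adj_delta mul_delta_mx.
have hw i j : schmidt_rank_le 1 (w i j).
  by exists (fun=> ket C i), (fun=> ket C j); rewrite big_ord1.
rewrite pair_big (LOCC2e_sum hLam) mulmx_sumr raddf_sum /=.
apply: le_trans (_ : \sum_(ij : 'I_N * 'I_N) (2 ^ e)%:R / N%:R <= _).
  apply: ler_sum => -[i j] _.
  have := epr_fidelity_le (LOCC2e_schmidt hLam (hw i j)).
  rewrite mul1n (LOCC2e_trace hLam) => /andP[_ /le_trans-> //].
  by rewrite /w ket_tens mxtrace_mulC adj_delta mul_delta_mx trace_mx11 mxE mulr1.
rewrite sumr_const card_prod card_ord -[_ *+ _]mulr_natr natrM mulrA divfK //.
by rewrite pnatr_eq0 expn_eq0.
Qed.

(** With the trivial Schmidt bound [N] the factor in [epr_fidelity_le] becomes 1, so positivity and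
    trace preservation of [Lam] suffice. *)
Lemma LOCC2e_fidelity a b : 0 <= \tr (Phi *m Lam (bell_state C a b)) <= \tr (bell_state C a b).
Proof.
pose u := (Xop C a *t Zop C b) *m epr_un C n.
have -> : bell_state C a b = N%:R^-1 *: (u *m adj u) by [].
have := LOCC2e_schmidt hLam (schmidt_rank_le_full u).
move=> /schmidt_number_le_full/epr_fidelity_le.
rewrite (LOCC2e_scale hLam) -scalemxAr !mxtraceZ.
rewrite (LOCC2e_trace hLam) mulfV ?mul1r ?pnatr_eq0 ?expn_eq0 // => /andP[h1 h2].
by rewrite mulr_ge0 ?ler_wpM2l ?invr_ge0 ?ler0n.
Qed.

Lemma LOCC2e_Enc1_fidelity : (0 < n)%N ->
  0 <= \tr (Phi *m Lam (Enc C n true)) <= 2 ^+ (1 + e) / 2 ^+ n.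
Proof.
move=> n0; pose f ab := \tr (Phi *m Lam (bell_state C ab.1 ab.2)).
have f0 ab : 0 <= f ab by case/andP: (LOCC2e_fidelity ab.1 ab.2).
have -> : \tr (Phi *m Lam (Enc C n true)) = (N * N - 1)%N%:R^-1 *
    \sum_(ab : bitv * bitv | ab != (zero_bits n, zero_bits n)) f ab.
  by rewrite /Enc (LOCC2e_scale hLam) (LOCC2e_sum hLam) -scalemxAr mxtraceZ mulmx_sumr raddf_sum.
have : \sum_(ab : bitv * bitv | ab != (zero_bits n, zero_bits n)) f ab <= (2 ^ e)%:R * N%:R.
  (* The Bell states sum to the identity, so passing to the identity adds just the nonnegative term
     of [Phi]. *)
  apply: le_trans LOCC2e_mixed_fidelity.
  rewrite -bell_complete (LOCC2e_sum hLam) mulmx_sumr raddf_sum /=.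
  rewrite [leRHS](bigD1 (zero_bits n, zero_bits n)) //= lerDr; apply: (f0 (_, _)).
set S := \sum_(_ | _) _ => hS.
rewrite mulr_ge0 ?sumr_ge0 ?invr_ge0 ?ler0n //=.
have hN : (2 <= N)%N by rewrite -[2%N]/(2 ^ 1)%N leq_pexp2l.
(* Conditioning on a nonzero pair costs at most a factor 2, hence the 1 in the exponent [1 + e]. *)
have hNN : (N * N <= 2 * (N * N - 1))%N by rewrite mulnBr leq_subRL; nia.
have N0 : 0 < (N * N - 1)%N%:R :> C by rewrite ltr0n subn_gt0; nia.
rewrite mulrC ler_pdivrMr // mulrAC ler_pdivlMr ?exprn_gt0 //.
apply: le_trans (_ : (2 ^ e)%:R * N%:R * 2 ^+ n <= _).
  by rewrite ler_wpM2r ?exprn_ge0.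
by rewrite -!natrX -!natrM ler_nat expnD; nia.
Qed.
End Malleability.

Lemma non_malleable_LOCC2e e : (0 < n)%N ->
  non_malleable (@Enc C n) (@Dec C n) (@LOCC2e C e N N) (2 ^+ (1 + e) / 2 ^+ n).
Proof.
move=> n0 Lam hLam.
have /andP[p0 p1] := LOCC2e_fidelity hLam (zero_bits n) (zero_bits n).
(* The two values of [Dec] add up to the trace, so correctness shows that codewords have trace 1. *)
have tE m : \tr (Lam (Enc C n m)) = 1.
  rewrite (LOCC2e_trace hLam); have := Enc_correct n0 m => h.
  have := congr2 (fun x y => x + y) (congr1 (@^~ true) h) (congr1 (@^~ false) h).
  by rewrite !DecE subrK => ->; case: m {h}; rewrite /point_distr ?addr0 ?add0r.
exists (\tr (Phi *m Lam (Enc C n false))), (point_distr C true).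
split; first by rewrite p0 -trace_epr.
split; first by split=> [m|]; rewrite ?ler0n // big_bool /point_distr /= addr0.
move=> m; rewrite /stat_dist big_bool !DecE tE /point_distr /=.
set p := \tr (Phi *m Lam (Enc C n false)); case: m.
  (* On message 1 the target is the point mass at 1 whatever [p] is, and the distance to it is
     exactly [q]. *)
  have := LOCC2e_Enc1_fidelity hLam n0.
  set q := \tr _ => /andP[q0 q1].
  rewrite !mulr1 !mulr0 addr0 subr0 [p + _]addrC subrK addrC addrAC subrr add0r.
  by rewrite normrN (ger0_norm q0) -mulr2n -[q *+ 2]mulr_natl mulKf ?pnatr_eq0.
(* On message 0 the output is 0 with probability [p] and 1 otherwise, which is the target itself. *)
rewrite -/p eqxx [true == _]/= mulr1 !mulr0 mulr1 add0r addr0 !subrr normr0 addr0 mulr0.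
by rewrite mulr_ge0 ?invr_ge0 ?exprn_ge0.
Qed.
End Bell.

(** For [n = 0] no nonzero pair exists to sample from: [Enc] sends 1 to the zero matrix and
    correctness fails, hence the positivity of [n]. *)
Theorem theorem6p1 (R : realType) (n e : nat) : (0 < n)%N ->
  perfectly_correct (@Enc R[i] n) (@Dec R[i] n) /\
  non_malleable (@Enc R[i] n) (@Dec R[i] n) (@LOCC2e R[i] e (2 ^ n) (2 ^ n))
    ((2 : R[i]) ^+ (1 + e) / (2 : R[i]) ^+ n).
Proof. by move=> n0; split; [exact: Enc_correct | exact: non_malleable_LOCC2e]. Qed.
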